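(* Let $G=(V,E)$ be a graph. Then $G$ is weakly critical if and only if $$\Psi(G)=\left\lfloor\frac{\omega(G)+|V|}{2}\right\rfloor .$$
   Context: All graphs are finite and simple; $|G|=|V|$ denotes the number of vertices of $G$. A coloring of a graph $G=(V,E)$ is a surjective map $\ell:V\to C$ onto a finite set $C$ of colors; it need not be proper. It is pseudocomplete if for any two distinct colors $i,j\in C$ there is an edge $uv\in E$ with $\{\ell(u),\ell(v)\}=\{i,j\}$. The pseudoachromatic number $\Psi(G)$ is the greatest number of colors used in a pseudocomplete coloring of $G$ (so $\Psi$ of the graph with no vertices is $0$). $\omega(G)$ is the clique number. For an integer $0\le k\le |G|$, $\operatorname{mpd}_G(k)=\min\{\Psi(G)-\Psi(G\setminus X) : X\subseteq V,\ |X|=k\}$, where $G\setminus X$ is the subgraph induced on $V\setminus X$. $G$ is weakly critical if $\operatorname{mpd}_G(k)\ge\lfloor k/2\rfloor$ for all $0\le k\le |G|$. *)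

(* Defs.v *)
From mathcomp Require Import all_boot.

Set Implicit Arguments.
Unset Strict Implicit.
Unset Printing Implicit Defensive.

Record sgraph := SGraph {
  vertex :> finType;
  adj : rel vertex;
  adj_sym : symmetric adj;
  adj_irr : irreflexive adj
}.

Definition induced_adj (G : sgraph) (S : {set G}) : rel {x : G | x \in S} :=
  fun x y => adj (val x) (val y).

Lemma induced_adj_sym (G : sgraph) (S : {set G}) :
  symmetric (@induced_adj G S).
Proof. by move=> x y; apply: adj_sym. Qed.

Lemma induced_adj_irr (G : sgraph) (S : {set G}) :
  irreflexive (@induced_adj G S).
Proof. by move=> x; apply: adj_irr. Qed.

Definition induced (G : sgraph) (S : {set G}) : sgraph :=
  SGraph (@induced_adj_sym G S) (@induced_adj_irr G S).

Definition delete_vertices (G : sgraph) (X : {set G}) : sgraph :=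
  induced (~: X).

Definition coloring (G : sgraph) (C : finType) (l : G -> C) : bool :=
  [forall c, exists v, l v == c].

Definition pseudocomplete (G : sgraph) (C : finType) (l : G -> C) : bool :=
  [forall i, forall j, (i != j) ==>
    [exists u, exists v, [&& adj u v, l u == i & l v == j]]].

Definition pc_colorable (G : sgraph) (k : nat) : bool :=
  [exists l : {ffun G -> 'I_k}, coloring l && pseudocomplete l].

(* Surjectivity forces k <= #|G|, so the bounded maximum loses nothing; see
   [Psi_max] and [Psi_attained]. *)
Definition Psi (G : sgraph) : nat :=
  \max_(k < #|G|.+1 | pc_colorable G k) k.

Definition clique (G : sgraph) (S : {set G}) : bool :=
  [forall u in S, forall v in S, (u != v) ==> adj u v].

Definition omega (G : sgraph) : nat := \max_(S : {set G} | clique S) #|S|.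

(* The subtraction never truncates ([Psi_delete_le]). The default value
   [Psi G] bounds every term from above, so for k <= #|G| (where the range is
   nonempty) it does not affect the minimum; see [mpd_min] and
   [mpd_attained]. *)
Definition mpd (G : sgraph) (k : nat) : nat :=
  \big[minn/Psi G]_(X : {set G} | #|X| == k)
    (Psi G - Psi (delete_vertices X)).

Definition weakly_critical (G : sgraph) : Prop :=
  forall k : nat, k <= #|G| -> k./2 <= mpd G k.

Lemma Psi_max (G : sgraph) (C : finType) (l : G -> C) :
  coloring l -> pseudocomplete l -> #|C| <= Psi G.
Proof.
move=> /forallP sl /forallP pl.
have leC : #|C| < #|G|.+1.
  have s c : {v | l v == c} by apply: sigW; apply/existsP.
  have inj : injective (fun c => sval (s c)).
    by move=> c d /= eq_cd; rewrite -(eqP (svalP (s c))) eq_cd (eqP (svalP (s d))).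
  by rewrite ltnS -(card_codom inj) max_card.
apply: (bigmax_sup (Ordinal leC)) => //=.
apply/existsP; exists [ffun v => enum_rank (l v)]; apply/andP; split.
  apply/forallP => i; have /existsP[v /eqP lv] := sl (enum_val i).
  by apply/existsP; exists v; rewrite ffunE lv enum_valK.
apply/forallP => i; apply/forallP => j; apply/implyP => ij.
have /forallP/(_ (enum_val j))/implyP := pl (enum_val i).
rewrite (inj_eq enum_val_inj) => /(_ ij) /existsP[u /existsP[v]].
case/and3P=> uv /eqP lu /eqP lv.
apply/existsP; exists u; apply/existsP; exists v.
by rewrite !ffunE uv lu lv !enum_valK !eqxx.
Qed.

Lemma Psi_attained (G : sgraph) :
  exists l : G -> 'I_(Psi G), coloring l /\ pseudocomplete l.
Proof.
suff: pc_colorable G (Psi G).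
  by case/existsP=> l /andP[sl pl]; exists l.
have [k Pk] : exists k : 'I_#|G|.+1, pc_colorable G k.
  case: (pickP G) => [x _ | G0].
    have G1 : 1 < #|G|.+1 by rewrite ltnS; apply/card_gt0P; exists x.
    exists (Ordinal G1); apply/existsP; exists [ffun => ord0].
    apply/andP; split; apply/forallP => i; rewrite (ord1 i).
      by apply/existsP; exists x; rewrite ffunE.
    by apply/forallP => j; rewrite (ord1 j).
  exists ord0; apply/existsP.
  exists (finfun (fun x : G => False_rect 'I_0 (notF (esym (G0 x))))).
  by apply/andP; split; apply/forallP => -[].
by rewrite /Psi (bigmax_eq_arg k) //; case: arg_maxnP.
Qed.

Lemma Psi_delete_le (G : sgraph) (X : {set G}) :
  Psi (delete_vertices X) <= Psi G.
Proof.
have [l [/forallP sl /forallP pl]] := Psi_attained (delete_vertices X).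
move: (Psi _) l sl pl => [|k] l sl pl //.
rewrite -[k.+1]card_ord.
pose f v := if insub v is Some w then l w else ord0.
have fE w : f (val w) = l w by rewrite /f valK.
apply: (@Psi_max _ _ f).
  apply/forallP => c; have /existsP[w lw] := sl c.
  by apply/existsP; exists (val w); rewrite fE.
apply/forallP => i; apply/forallP => j; apply/implyP => ij.
have /forallP/(_ j)/implyP/(_ ij)/existsP[u /existsP[v]] := pl i.
case/and3P=> uv lu lv; apply/existsP; exists (val u); apply/existsP.
by exists (val v); rewrite !fE lu lv !andbT; apply: uv.
Qed.

Lemma mpd_min (G : sgraph) (X : {set G}) :
  mpd G #|X| <= Psi G - Psi (delete_vertices X).
Proof.
rewrite /mpd -big_filter.
set s := filter _ _.
have: X \in s by rewrite mem_filter eqxx mem_index_enum.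
elim: s => // Y s IHs; rewrite big_cons inE geq_min.
by case/predU1P => [<-|/IHs ->]; rewrite ?leqnn ?orbT.
Qed.

Lemma mpd_attained (G : sgraph) (k : nat) : k <= #|G| ->
  exists2 X : {set G}, #|X| = k & mpd G k = Psi G - Psi (delete_vertices X).
Proof.
move=> lek.
have [X0 X0k] : exists X : {set G}, #|X| == k.
  have szk : size (take k (enum G)) = k by rewrite size_takel // -cardE.
  exists [set x in take k (enum G)].
  by rewrite cardsE (card_uniqP _) ?szk // take_uniq // enum_uniq.
pose F (X : {set G}) := Psi G - Psi (delete_vertices X).
case: (@arg_minnP _ X0 (fun X => #|X| == k) F X0k) => X /eqP Xk minX; exists X => //.
apply/eqP; rewrite eqn_leq -{1}Xk mpd_min /=.
rewrite /mpd; elim/big_rec: _ => [|Y m Yk le_m]; first exact: leq_subr.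
by rewrite leq_min le_m (minX Y Yk).
Qed.

(* Main.v *)
Require Import Defs.
From mathcomp Require Import all_boot.
From mathcomp Require Import zify.

(** The quantity (omega G + #|G|)./2 is always an upper bound for Psi G: in a
    pseudocomplete coloring, the vertices that are alone in their color class
    are pairwise adjacent, so there are at most omega G of them, and every
    other class has at least two vertices ([Psi_le_half]).

    If the bound is attained by G, deleting k vertices lowers the right-hand
    side by at least k./2, because omega does not grow, and hence lowers Psi by
    at least as much: G is weakly critical.  Conversely, deleting all vertices
    outside a maximum clique leaves a graph with Psi at least omega G
    ([complete_Psi]); weak criticality for this one set of vertices says that
    Psi G is at least omega G + (#|G| - omega G)./2, which is the bound. *)

Lemma clique_le_omega (G : sgraph) (S : {set G}) : clique S -> #|S| <= omega G.
Proof. by move=> clS; apply: (bigmax_sup S). Qed.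

Lemma omega_attained (G : sgraph) :
  exists2 S : {set G}, clique S & #|S| = omega G.
Proof.
have cl0 : @clique G set0 by apply/forall_inP => u; rewrite inE.
rewrite /omega (bigmax_eq_arg set0) //.
by case: arg_maxnP => // S clS _; exists S.
Qed.

Lemma omega_delete_le (G : sgraph) (X : {set G}) :
  omega (delete_vertices X) <= omega G.
Proof.
have [S /forall_inP clS <-] := omega_attained (delete_vertices X).
rewrite -(card_imset _ val_inj); apply: clique_le_omega.
apply/forall_inP => _ /imsetP[u uS ->]; apply/forall_inP => _ /imsetP[v vS ->].
by apply/implyP => uv; have /forall_inP/(_ v vS)/implyP := clS u uS; apply.
Qed.

Lemma card_delete (G : sgraph) (X : {set G}) :
  #|delete_vertices X| = #|G| - #|X|.
Proof.
have -> : #|delete_vertices X| = #|~: X| by rewrite card_sig; apply: eq_card.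
by rewrite cardsCs setCK.
Qed.

Lemma complete_Psi (G : sgraph) :
  (forall u v : G, u != v -> adj u v) -> #|G| <= Psi G.
Proof.
move=> cG; apply: (@Psi_max G G id).
  by apply/forallP => c; apply/existsP; exists c.
apply/forallP => i; apply/forallP => j; apply/implyP => ij.
by apply/existsP; exists i; apply/existsP; exists j; rewrite cG // !eqxx.
Qed.

Definition lone_vertices (G : sgraph) (C : finType) (l : G -> C) : {set G} :=
  [set v | [forall u, (l u == l v) ==> (u == v)]].

(** An edge joining the classes of two lone vertices can only be the edge
    between these vertices. *)
Lemma lone_vertices_clique (G : sgraph) (C : finType) (l : G -> C) :
  pseudocomplete l -> clique (lone_vertices G C l).
Proof.
move=> /forallP pl.
apply/forall_inP => u; rewrite inE => /forallP lone_u.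
apply/forall_inP => v; rewrite inE => /forallP lone_v.
apply/implyP => uv.
have luv : l u != l v.
  by apply: contraNneq uv => luv; apply: (implyP (lone_v u)); rewrite luv.
have /forallP/(_ (l v))/implyP/(_ luv)/existsP[a /existsP[b]] := pl (l u).
case/and3P=> ab lau lbv.
by rewrite -(eqP (implyP (lone_u a) lau)) -(eqP (implyP (lone_v b) lbv)).
Qed.

(** Each class contributes at least 2 to the right-hand side: a class with a
    single vertex is counted in both terms. *)
Lemma double_colors_le (G : sgraph) (C : finType) (l : G -> C) :
  coloring l -> #|C|.*2 <= #|lone_vertices G C l| + #|G|.
Proof.
move=> /forallP sl; set S := lone_vertices G C l.
rewrite -(sum1_card (mem S)) -(sum1_card G).
rewrite (partition_big l xpredT) //= [X in _ + X](partition_big l xpredT) //=.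
rewrite -big_split /= -muln2 -sum_nat_const; apply: leq_sum => c _.
have /existsP[v /eqP lv] := sl c; rewrite !sum1_card.
have [vS | ] := boolP (v \in S).
  apply: (@leq_add 1 1); apply/card_gt0P; exists v; last exact/eqP.
  by apply/andP; split; last exact/eqP.
rewrite in_set => /forallPn[u]; rewrite negb_imply lv => /andP[/eqP luc uv].
apply: leq_trans (leq_addl _ _); apply/card_gt1P; exists u, v.
by split=> //; apply/eqP.
Qed.

Lemma Psi_le_half (G : sgraph) : Psi G <= (omega G + #|G|)./2.
Proof.
have [l [sl pl]] := Psi_attained G.
have := double_colors_le _ _ _ sl.
have := clique_le_omega _ _ (lone_vertices_clique _ _ _ pl).
rewrite card_ord; lia.
Qed.

Theorem theorem4p3 (G : sgraph) :
  weakly_critical G <-> Psi G = (omega G + #|G|)./2.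
Proof.
split=> [wcG | PsiG k lek].
  have [S clS cardS] := omega_attained G.
  have leS : #|S| <= #|G| := max_card _.
  have cardX : #|~: S| = #|G| - #|S| by rewrite cardsCs setCK.
  have PsiS : #|S| <= Psi (delete_vertices (~: S)).
    have -> : #|S| = #|delete_vertices (~: S)| by rewrite card_delete cardX subKn.
    apply: complete_Psi => u v uv.
    have inS (w : delete_vertices (~: S)) : val w \in S.
      by case: w => x xS; move: (xS); rewrite setCK.
    by have /forall_inP/(_ _ (inS v))/implyP := forall_inP clS _ (inS u); apply.
  have := leq_trans (wcG _ (max_card _)) (mpd_min (~: S)).
  have := Psi_le_half G; have := Psi_delete_le (~: S); lia.
have [X cardX ->] := mpd_attained lek.
have := Psi_le_half (delete_vertices X); have := omega_delete_le _ X.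
by rewrite card_delete cardX PsiG; lia.
Qed.
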